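(* Let $n$ be an odd number and $h_n:=\frac{n-1}{2}$. Let $m\ge 0$ and $\beta\ge 1$ be integers such that $m+\beta\le h_n$. Let $s,x\in\mathbb{R}^{n+1}$ with $s\notin[x]$, and let $D$ and $\Delta_{n+1}$ be the Dirac and Laplace operators applied with respect to the variable $x$. Set $\gamma_m=4^m\, m!\,(-h_n)_m$. (i) If $\beta=2k_1+1$, where $k_1\ge 0$ is an integer, then $$D^{\beta}\left(\Delta_{n+1}^m S_L^{-1}(s,x)\right)=\frac{2^{\beta}(h_n-m)\gamma_m}{m!}\left((s-\bar x)\sum_{j=0}^{k_1-1}a^1_{j,k_1,m}\,\mathcal{Q}_{c,s}^{-m-j-2-k_1}(x)(s-x_0)^{2j+1}-\sum_{j=0}^{k_1}b^1_{j,k_1,m}\,\mathcal{Q}_{c,s}^{-m-1-k_1-j}(x)(s-x_0)^{2j}\right),$$ where $$a^1_{j,k_1,m}:=2^{2j+1}(m+k_1+1+j)!\,(k_1-j-1)!\binom{k_1+j}{2j+1}\binom{h_n-m-k_1-j-2}{h_n-m-2k_1-1},$$ $$b^1_{j,k_1,m}:=2^{2j}(k_1-j)!\,(m+k_1+j)!\binom{h_n-m-k_1-j-1}{h_n-m-2k_1-1}\binom{k_1+j}{2j}.$$ (ii) If $\beta=2k_2$, where $k_2\ge 1$ is an integer, then $$D^{\beta}\left(\Delta_{n+1}^m S_L^{-1}(s,x)\right)=\frac{2^{\beta}(h_n-m)\gamma_m}{m!}\left((s-\bar x)\sum_{j=0}^{k_2-1}a^2_{j,k_2,m}\,\mathcal{Q}_{c,s}^{-m-j-1-k_2}(x)(s-x_0)^{2j}-\sum_{j=0}^{k_2-1}b^2_{j,k_2,m}\,\mathcal{Q}_{c,s}^{-m-1-k_2-j}(x)(s-x_0)^{2j+1}\right),$$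 where $$a^2_{j,k_2,m}:=2^{2j}(m+k_2+j)!\,(k_2-j-1)!\binom{k_2+j-1}{2j}\binom{h_n-m-k_2-1-j}{h_n-m-2k_2},$$ $$b^2_{j,k_2,m}:=2^{2j+1}(k_2-j-1)!\,(m+k_2+j)!\binom{h_n-m-k_2-1-j}{h_n-m-2k_2}\binom{k_2+j}{2j+1}.$$
   Context: $\mathbb{R}_n$ is the real Clifford algebra generated by $e_1,\dots,e_n$ with $e_ie_j+e_je_i=-2\delta_{ij}$. A point $(x_0,\dots,x_n)\in\mathbb{R}^{n+1}$ is identified with the paravector $x=x_0+\underline{x}\in\mathbb{R}_n$, $\underline{x}=\sum_{i=1}^n x_ie_i$; its conjugate is $\bar x=x_0-\underline{x}$ and $|x|^2=x_0^2+\dots+x_n^2$. $\mathbb{S}$ is the set of $1$-vectors $\underline{x}$ with $x_1^2+\dots+x_n^2=1$, and $[x]:=\{x_0+J|\underline{x}| : J\in\mathbb{S}\}$. For $s,x\in\mathbb{R}^{n+1}$, $\mathcal{Q}_{c,s}(x):=s^2-2x_0s+|x|^2$; it is invertible in $\mathbb{R}_n$ when $s\notin[x]$ (equivalently $x\notin[s]$), and $\mathcal{Q}_{c,s}^{-\ell}(x):=(\mathcal{Q}_{c,s}(x)^{-1})^{\ell}$ for integers $\ell\ge0$. The left slice hyperholomorphic Cauchy kernel is (in its second form) $S_L^{-1}(s,x)=(s-\bar x)\mathcal{Q}_{c,s}^{-1}(x)$. The Dirac operator acts on $\mathbb{R}_n$-valued functions of $x$ from the left: $Df=\partial_{x_0}f+\sum_{i=1}^n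 e_i\partial_{x_i}f$. $\Delta_{n+1}=\sum_{i=0}^n\partial_{x_i}^2$ is the Laplacian in the $n+1$ variables. Powers of operators denote iteration. For integers $0\le m\le h_n$: $(-h_n)_m=(-1)^m\frac{h_n!}{(h_n-m)!}$. Empty sums are $0$, and $(s-x_0)^0=1$. *)

(* Defs.v *)
From HB Require Import structures.
From mathcomp Require Import all_boot all_order all_algebra.
From mathcomp Require Import boolp.

Set Implicit Arguments.
Unset Strict Implicit.
Unset Printing Implicit Defensive.

Import Order.TTheory GRing.Theory Num.Theory.

Local Open Scope ring_scope.

Section SymmetricDifference.
Variables (I : finType).
Implicit Types A B C : {set I}.

Definition symdiff A B : {set I} := (A :\: B) :|: (B :\: A).

Lemma in_symdiff A B i : (i \in symdiff A B) = (i \in A) (+) (i \in B).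
Proof. by rewrite !inE; case: (i \in A); case: (i \in B). Qed.

Lemma symdiffA : associative symdiff.
Proof. by move=> A B C; apply/setP => i; rewrite !in_symdiff addbA. Qed.

Lemma symdiffC : commutative symdiff.
Proof. by move=> A B; apply/setP => i; rewrite !in_symdiff addbC. Qed.

Lemma symdiff0 A : symdiff A set0 = A.
Proof. by apply/setP => i; rewrite in_symdiff inE addbF. Qed.

Lemma symdiffv A : symdiff A A = set0.
Proof. by apply/setP => i; rewrite in_symdiff inE addbb. Qed.

Lemma symdiffK A : involutive (symdiff A).
Proof. by move=> B; rewrite symdiffA symdiffv symdiffC symdiff0. Qed.

Lemma prod_symdiff (R : comNzRingType) (f : I -> R) A B :
  (forall i, f i * f i = 1) ->
  \prod_(i in symdiff A B) f i = \prod_(i in A) f i * \prod_(i in B) f i.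
Proof.
move=> ff; rewrite [LHS]big_mkcond [X in X * _]big_mkcond.
rewrite [X in _ * X]big_mkcond -big_split; apply: eq_bigr => i _ /=.
by rewrite in_symdiff; case: (i \in A); case: (i \in B);
  rewrite ?ff ?mul1r ?mulr1.
Qed.

End SymmetricDifference.

(* The real Clifford algebra R_n with e_i e_j + e_j e_i = -2 delta_ij:
   an element is its family of coordinates on the basis
   e_A = e_{i_1} ... e_{i_k}, A = {i_1 < ... < i_k}.  Sorting the product
   e_A e_B costs one sign for each pair (i, j) in A x B with j < i, and one for
   each i common to A and B since e_i ^ 2 = -1.  The generators e_1, ..., e_n
   are indexed from 0 by 'I_n. *)
Definition clifford (R : Type) (n : nat) : Type := {ffun {set 'I_n} -> R}.

HB.instance Definition _ (R : comNzRingType) n :=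
  GRing.Lmodule.copy (clifford R n) {ffun {set 'I_n} -> R^o}.

Section CliffordRing.
Variables (R : comNzRingType) (n : nat).
Implicit Types (A B C : {set 'I_n}) (x y z : clifford R n).

Definition cl_sign A B : R :=
  (-1) ^+ #|[set p in setX A B | (p.2 <= p.1)%N]|.

Definition cl_basis A : clifford R n := [ffun B => (A == B)%:R].

Definition cl_mul x y : clifford R n :=
  [ffun C => \sum_A cl_sign A (symdiff A C) * (x A * y (symdiff A C))].

Definition cl_one : clifford R n := cl_basis set0.

Let sg (i j : 'I_n) : R := if (j <= i)%N then -1 else 1.

Let sg2 i j : sg i j * sg i j = 1.
Proof. by rewrite /sg; case: ifP => _; rewrite ?mulrNN mulr1. Qed.

Lemma cl_signE A B : cl_sign A B = \prod_(i in A) \prod_(j in B) sg i j.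
Proof.
rewrite pair_big_dep /= /cl_sign -big_mkcondr /= -prodr_const.
by apply: eq_bigl => -[i j]; rewrite !inE.
Qed.

Lemma cl_signDl A B C :
  cl_sign (symdiff A B) C = cl_sign A C * cl_sign B C.
Proof.
rewrite !cl_signE prod_symdiff // => i; rewrite -big_split /=.
by rewrite big1 // => j _; rewrite sg2.
Qed.

Lemma cl_signDr A B C :
  cl_sign A (symdiff B C) = cl_sign A B * cl_sign A C.
Proof.
rewrite !cl_signE -big_split /=; apply: eq_bigr => i _.
by rewrite prod_symdiff // => j; rewrite sg2.
Qed.

Lemma cl_sign0l A : cl_sign set0 A = 1.
Proof. by rewrite cl_signE big_set0. Qed.

Lemma cl_sign0r A : cl_sign A set0 = 1.
Proof. by rewrite cl_signE big1 // => i _; rewrite big_set0. Qed.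

Let cl_mulA : associative cl_mul.
Proof.
move=> x y z; apply/ffunP => D; rewrite !ffunE.
transitivity (\sum_A \sum_B cl_sign A (symdiff A D) *
    cl_sign B (symdiff B (symdiff A D)) *
    (x A * y B * z (symdiff B (symdiff A D)))).
  apply: eq_bigr => A _; rewrite ffunE mulr_sumr mulr_sumr.
  apply: eq_bigr => B _; rewrite -!mulrA; congr (_ * _).
  by rewrite mulrCA; congr (_ * _); rewrite mulrA.
rewrite exchange_big /= [RHS](eq_bigr (fun C =>
    \sum_A cl_sign C (symdiff C D) * (cl_sign A (symdiff A C) *
      (x A * y (symdiff A C)) * z (symdiff C D)))); last first.
  by move=> C _; rewrite ffunE mulr_suml mulr_sumr.
rewrite [RHS]exchange_big /= exchange_big /=; apply: eq_bigr => A _.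
rewrite [RHS](reindex_inj (can_inj (symdiffK A))) /=.
apply: eq_bigr => B _; rewrite symdiffK.
have -> : symdiff B (symdiff A D) = symdiff (symdiff A B) D.
  by rewrite symdiffA (symdiffC B).
rewrite !mulrA; congr (_ * _ * _ * _).
rewrite !(cl_signDl, cl_signDr).
have sq E F : cl_sign E F * cl_sign E F = 1.
  by rewrite -cl_signDl symdiffv cl_sign0l.
by rewrite [RHS]mulrC !mulrA [_ * cl_sign A A]mulrC -[_ * _ * cl_sign A B]mulrA
  sq mulr1.
Qed.

Let cl_mul1l : left_id cl_one cl_mul.
Proof.
move=> x; apply/ffunP => C; rewrite ffunE (bigD1 set0) //= big1 ?addr0.
  by rewrite ffunE eqxx mul1r (symdiffC set0) symdiff0 cl_sign0l mul1r.
by move=> A /negPf A0; rewrite ffunE eq_sym A0 mul0r mulr0.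
Qed.

Let cl_mul1r : right_id cl_one cl_mul.
Proof.
move=> x; apply/ffunP => C; rewrite ffunE (bigD1 C) //= big1 ?addr0.
  by rewrite ffunE symdiffv eqxx mulr1 cl_sign0r mul1r.
move=> A AC; rewrite ffunE; case: eqP => [e|_]; last by rewrite !mulr0.
by case/eqP: AC; rewrite -(symdiffK A C) -e symdiff0.
Qed.

Let cl_mulDl : left_distributive cl_mul +%R.
Proof.
move=> x y z; apply/ffunP => C; rewrite !ffunE -big_split /=.
by apply: eq_bigr => A _; rewrite !ffunE mulrDl mulrDr.
Qed.

Let cl_mulDr : right_distributive cl_mul +%R.
Proof.
move=> x y z; apply/ffunP => C; rewrite !ffunE -big_split /=.
by apply: eq_bigr => A _; rewrite !ffunE !mulrDr.
Qed.

Let cl_one_neq0 : cl_one != 0.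
Proof.
by apply/eqP => /ffunP/(_ set0)/eqP; rewrite !ffunE eqxx oner_eq0.
Qed.

HB.instance Definition _ := GRing.Zmodule_isNzRing.Build (clifford R n)
  cl_mulA cl_mul1l cl_mul1r cl_mulDl cl_mulDr cl_one_neq0.

Let cl_scaleAl (a : R) x y : a *: (x * y) = (a *: x) * y.
Proof.
apply/ffunP => C; rewrite !ffunE scaler_sumr; apply: eq_bigr => A _.
by rewrite ffunE -mulrA [in LHS]/GRing.scale /= mulrCA.
Qed.

HB.instance Definition _ :=
  GRing.Lmodule_isLalgebra.Build R (clifford R n) cl_scaleAl.

Let cl_scaleAr (a : R) x y : a *: (x * y) = x * (a *: y).
Proof.
apply/ffunP => C; rewrite !ffunE scaler_sumr; apply: eq_bigr => A _.
by rewrite ffunE [in LHS]/GRing.scale /= mulrCA; congr (_ * _); rewrite mulrCA.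
Qed.

HB.instance Definition _ :=
  GRing.Lalgebra_isAlgebra.Build R (clifford R n) cl_scaleAr.

(* Inverses exist only classically here: x^-1 is the two-sided inverse of x
   whenever there is one, and x otherwise (MathComp convention). *)
Definition cl_inv_spec x y := y * x = 1 /\ x * y = 1.
Definition cl_unit : pred (clifford R n) := fun x => `[< exists y, cl_inv_spec x y >].
Definition cl_inv x : clifford R n :=
  if pselect (exists y, cl_inv_spec x y) is left xP then projT1 (cid xP) else x.

Let cl_mulVr : {in cl_unit, left_inverse 1 cl_inv *%R}.
Proof.
move=> x /asboolP xP; rewrite /cl_inv; case: pselect => // xP'.
by case: cid => y [].
Qed.

Let cl_divrr : {in cl_unit, right_inverse 1 cl_inv *%R}.
Proof.
move=> x /asboolP xP; rewrite /cl_inv; case: pselect => // xP'.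
by case: cid => y [].
Qed.

Let cl_unitrP x y : y * x = 1 /\ x * y = 1 -> cl_unit x.
Proof. by move=> xy; apply/asboolP; exists y. Qed.

Let cl_inv_out : {in [predC cl_unit], cl_inv =1 id}.
Proof.
move=> x; rewrite inE /= => /asboolP xP.
by rewrite /cl_inv; case: pselect.
Qed.

HB.instance Definition _ := GRing.NzRing_hasMulInverse.Build (clifford R n)
  cl_mulVr cl_divrr cl_unitrP cl_inv_out.

Definition cl_gen (i : 'I_n) : clifford R n := cl_basis [set i].

Lemma cl_basisM A B :
  cl_basis A * cl_basis B = cl_sign A B *: cl_basis (symdiff A B).
Proof.
apply/ffunP => C; rewrite !ffunE (bigD1 A) //= big1 ?addr0; last first.
  by move=> D /negPf DA; rewrite ffunE eq_sym DA mul0r mulr0.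
rewrite !ffunE eqxx mul1r (can2_eq (symdiffK A) (symdiffK A)).
by case: eqP => [->|_]; rewrite ?symdiffK /GRing.scale /= ?mulr0.
Qed.

Lemma cl_gen_anticomm i j :
  cl_gen i * cl_gen j + cl_gen j * cl_gen i = (- 2 *+ (i == j))%:A.
Proof.
rewrite /cl_gen !cl_basisM (symdiffC [set j]) -scalerDl !cl_signE !big_set1.
rewrite /sg; case: (eqVneq i j) => [->|ij].
  by rewrite leqnn symdiffv mulr1n -opprD.
have := ij; rewrite -(inj_eq val_inj) /= => /negPf ijv.
rewrite mulr0n scale0r (_ : _ + _ = 0) ?scale0r //.
by case: ltngtP ijv => // _ _; rewrite ?subrr ?addNr.
Qed.

End CliffordRing.

(* Imported only here: classical_sets shadows the finset notations used above. *)
From mathcomp Require Import all_classical all_reals all_analysis.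
Import numFieldNormedType.Exports.
Local Open Scope ring_scope.

Section SliceHyperholomorphic.
Variables (R : realType) (n : nat).
Local Notation Cl := (clifford R n).
Local Notation V := 'rV[R]_n.+1.
Implicit Types (x s : V) (f : V -> Cl).

Definition vector_part x : Cl := \sum_(i < n) x 0 (lift ord0 i) *: cl_gen R i.
Definition paravector x : Cl := (x 0 0)%:A + vector_part x.
Definition para_conj x : Cl := (x 0 0)%:A - vector_part x.
Definition normsq x : R := \sum_(i < n.+1) x 0 i ^+ 2.
Definition vector_norm x : R := Num.sqrt (\sum_(i < n) x 0 (lift ord0 i) ^+ 2).

Definition unit_1vectors : set Cl :=
  [set J | exists u : 'rV[R]_n,
     \sum_(i < n) u 0 i ^+ 2 = 1 /\ J = \sum_(i < n) u 0 i *: cl_gen R i].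

Definition slice_sphere x : set Cl :=
  [set (x 0 0)%:A + vector_norm x *: J | J in unit_1vectors].

Definition Qc s x : Cl :=
  paravector s ^+ 2 - (2 * x 0 0) *: paravector s + (normsq x)%:A.

Definition Qc_negpow s x (l : nat) : Cl := (Qc s x)^-1 ^+ l.

Definition SL_kernel s x : Cl := (paravector s - para_conj x) * (Qc s x)^-1.

(* Clifford-valued functions are differentiated coordinatewise on the basis
   e_A, with the directional derivative of real-valued functions. *)
Definition partial_deriv (i : 'I_n.+1) f : V -> Cl :=
  fun x => [ffun A => 'D_(delta_mx 0 i) (fun y : V => f y A : R^o) x].

Definition dirac_op f : V -> Cl := fun x =>
  partial_deriv ord0 f x + \sum_(i < n) cl_gen R i * partial_deriv (lift ord0 i) f x.

Definition laplacian f : V -> Cl := fun x =>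
  \sum_(i < n.+1) partial_deriv i (partial_deriv i f) x.

End SliceHyperholomorphic.

Section Coefficients.
Variable R : realType.

(* (-h)_m, for m <= h *)
Definition pochhammer_neg (h m : nat) : R :=
  (-1) ^+ m * (h`!%:R / (h - m)`!%:R).

Definition gamma_coef (h m : nat) : R := 4 ^+ m * m`!%:R * pochhammer_neg h m.

(* In the four families below every truncated subtraction is exact on the
   summation range, given m + 2 * k + 1 <= h, resp. m + 2 * k <= h. *)
Definition coef_a1 (h m k j : nat) : R :=
  (2 ^ (2 * j + 1) * (m + k + 1 + j)`! * (k - j - 1)`! *
   'C(k + j, 2 * j + 1) * 'C(h - m - k - j - 2, h - m - 2 * k - 1))%N%:R.

Definition coef_b1 (h m k j : nat) : R :=
  (2 ^ (2 * j) * (k - j)`! * (m + k + j)`! *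
   'C(h - m - k - j - 1, h - m - 2 * k - 1) * 'C(k + j, 2 * j))%N%:R.

Definition coef_a2 (h m k j : nat) : R :=
  (2 ^ (2 * j) * (m + k + j)`! * (k - j - 1)`! *
   'C(k + j - 1, 2 * j) * 'C(h - m - k - 1 - j, h - m - 2 * k))%N%:R.

Definition coef_b2 (h m k j : nat) : R :=
  (2 ^ (2 * j + 1) * (k - j - 1)`! * (m + k + j)`! *
   'C(h - m - k - 1 - j, h - m - 2 * k) * 'C(k + j, 2 * j + 1))%N%:R.

End Coefficients.

(* Main.v *)
(* Write t = s - x_0, let v be the vector part of x, and put
   M(k, l) = Q^(-k) t^l and E(k, l) = (s - conj x) M(k, l) = M(k, l+1) + v M(k, l).
   Since Q = t^2 + |v|^2, where t and Q commute, and n = 2h + 1, one gets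
     D M(k, l) = - 2k E(k+1, l) + 4k M(k+1, l+1) - l M(k, l-1),
     D E(k, l) = - l E(k, l-1) - 2 (h + 1 - k) M(k, l),
     Laplacian E(k, 0) = - 4k (h + 1 - k) E(k+1, 0).
   The last formula yields Laplacian^m S_L^(-1) = gamma_m E(m+1, 0); the first
   two turn the claimed expressions for D^beta into four recurrences between the
   coefficients a^1, b^1, a^2, b^2, which are identities between factorials. *)
Require Import Defs.
From HB Require Import structures.
From mathcomp Require Import all_boot all_order all_algebra.
From mathcomp Require Import all_classical all_reals all_analysis.
From mathcomp Require Import ring lra zify.

Set Implicit Arguments.
Unset Strict Implicit.
Unset Printing Implicit Defensive.

Import Order.TTheory GRing.Theory Num.Theory.
Import numFieldNormedType.Exports.

Local Open Scope ring_scope.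

(** * Coordinates of Clifford elements and bilinearity of the product *)

Section CliffordCoordinates.
Variables (R : comNzRingType) (n : nat).
Implicit Types (f g h : clifford R n) (a : R) (A : {set 'I_n}).

Lemma clDE f g A : (f + g) A = f A + g A.
Proof. by rewrite ffunE. Qed.
Lemma clNE f A : (- f) A = - f A.
Proof. by rewrite ffunE. Qed.
Lemma clZE a f A : (a *: f) A = a * f A.
Proof. by rewrite ffunE. Qed.
Lemma cl0E A : (0 : clifford R n) A = 0.
Proof. by rewrite ffunE. Qed.
Lemma clME f g A :
  (f * g) A = \sum_B cl_sign R B (symdiff B A) * (f B * g (symdiff B A)).
Proof. by rewrite ffunE. Qed.

(* Same as the library lemmas, except that all products they leave are
   syntactically on the ring structure of [clifford R n]. *)
Lemma cl_mul1r f : 1 * f = f. Proof. exact: mul1r. Qed.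
Lemma cl_mulr1 f : f * 1 = f. Proof. exact: mulr1. Qed.
Lemma cl_scalerAl a f g : (a *: f) * g = a *: (f * g). Proof. by rewrite scalerAl. Qed.
Lemma cl_scalerAr a f g : f * (a *: g) = a *: (f * g). Proof. by rewrite scalerAr. Qed.
Lemma cl_mulrDl f g h : (f + g) * h = f * h + g * h. Proof. exact: mulrDl. Qed.
Lemma cl_mulrDr f g h : f * (g + h) = f * g + f * h. Proof. exact: mulrDr. Qed.
Lemma cl_mulrBl f g h : (f - g) * h = f * h - g * h. Proof. exact: mulrBl. Qed.
Lemma cl_mulrBr f g h : f * (g - h) = f * g - f * h. Proof. exact: mulrBr. Qed.

Definition cl_distrE := (cl_mulrBl, cl_mulrBr, cl_mulrDl, cl_mulrDr,
  cl_scalerAl, cl_scalerAr, cl_mul1r, cl_mulr1).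

Definition clE := (clDE, clNE, clZE, cl0E).

End CliffordCoordinates.

(** Serves for identities that are linear over the scalars: at a fixed basis coordinate they become
    identities in a commutative ring, where each Clifford product counts as one unknown. *)
Ltac cl_ring := apply/ffunP => ?; rewrite !clE; ring.

(** * Partial derivatives of Clifford-valued functions *)

Section PartialDerivatives.
Variables (R : realType) (n : nat).
Local Notation Cl := (clifford R n).
Local Notation V := 'rV[R]_n.+1.
Implicit Types (x : V) (f g : V -> Cl) (df dg : Cl) (i : 'I_n.+1).

(** [partial_deriv] has a value even where no derivative exists; this relation also records
    differentiability of every coordinate, which the sum and product rules need. *)
Definition is_partial i f x df :=
  forall A, is_derive x (delta_mx 0 i : V) (fun y : V => f y A : R^o) (df A).

Lemma is_partial_eq i f x df dg : is_partial i f x df -> df = dg -> is_partial i f x dg.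
Proof. by move=> h <-. Qed.

Lemma partial_derivE i f x df : is_partial i f x df -> partial_deriv i f x = df.
Proof. by move=> h; apply/ffunP => A; rewrite ffunE; have [_ ->] := h A. Qed.

Lemma is_partial_near i f g x df :
  (\forall y \near x, f y = g y) -> is_partial i f x df -> is_partial i g x df.
Proof.
move=> fg h A; have := h A; apply: near_eq_is_derive.
by near=> y; rewrite (near fg y).
Unshelve. all: by end_near. Qed.

Lemma is_partial_cst i c x : is_partial i (fun=> c) x 0.
Proof. by move=> A; rewrite cl0E; apply: is_derive_cst. Qed.

Lemma is_partialD i f g x df dg :
  is_partial i f x df -> is_partial i g x dg ->
  is_partial i (fun y => f y + g y) x (df + dg).
Proof.
move=> hf hg A; rewrite clDE.
rewrite (_ : (fun y : V => (f y + g y) A) = (fun y : V => f y A : R^o) + (fun y => g y A)).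
  by apply: is_deriveD.
by apply/funext => y; rewrite clDE.
Qed.

Lemma is_partialZ i (k : R) f x df :
  is_partial i f x df -> is_partial i (fun y => k *: f y) x (k *: df).
Proof.
move=> hf A; rewrite clZE.
rewrite (_ : (fun y : V => (k *: f y) A) = k \*: (fun y : V => f y A : R^o)).
  by apply: is_deriveZ.
by apply/funext => y; rewrite clZE.
Qed.

Lemma is_partial_sum (I : Type) (r : seq I) i (F : I -> V -> Cl) x (dF : I -> Cl) :
  (forall k, is_partial i (F k) x (dF k)) ->
  is_partial i (fun y => \sum_(k <- r) F k y) x (\sum_(k <- r) dF k).
Proof.
move=> hF; elim: r => [|k r IH].
  rewrite big_nil (_ : (fun _ => _) = (fun=> 0)); first exact: is_partial_cst.
  by apply/funext => y; rewrite big_nil.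
rewrite big_cons (_ : (fun _ => _) = (fun y => F k y + \sum_(k <- r) F k y)).
  exact: is_partialD.
by apply/funext => y; rewrite big_cons.
Qed.

(** Each coordinate of a product is a finite sum of products of real coordinates, so the real
    Leibniz rule applies term by term; the factors keep their order, as they need not commute. *)
Lemma is_partialM i f g x df dg :
  is_partial i f x df -> is_partial i g x dg ->
  is_partial i (fun y => f y * g y) x (df * g x + f x * dg).
Proof.
move=> hf hg A; rewrite clDE !clME -big_split /=.
rewrite (_ : (fun y : V => (f y * g y) A) = fun y => \sum_(B : {set 'I_n})
   cl_sign R B (symdiff B A) * (f y B * g y (symdiff B A))); last first.
  by apply/funext => y; rewrite clME.
elim: (index_enum _) => [|B r IH].
  rewrite big_nil (_ : (fun _ => _) = (fun=> 0)); first exact: is_derive_cst.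
  by apply/funext => y; rewrite big_nil.
rewrite big_cons; set F := (fun y => _) in IH.
rewrite (_ : (fun _ => _) = cl_sign R B (symdiff B A) \*: ((fun y : V => f y B : R) *
   (fun y : V => g y (symdiff B A) : R)) + (F : V -> R^o)); last first.
  by apply/funext => y; rewrite big_cons.
apply: is_deriveD.
apply: is_derive_eq.
  by apply: is_deriveZ; apply: is_deriveM.
rewrite /GRing.scale /=; ring.
Qed.

Lemma is_derive_coord x i j :
  is_derive x (delta_mx 0 i : V) (fun y : V => y 0 j : R^o) (i == j)%:R.
Proof.
have H : ((fun h : R => h^-1 *: ((h *: delta_mx 0 i + x) 0 j - x 0 j : R^o)) @ 0^'
    --> ((i == j)%:R : R^o))%classic.
  (* Away from [h = 0] the difference quotient of a coordinate is constant. *)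
  apply: (@cvg_trans _ ((fun=> (i == j)%:R : R^o) @ (0 : R)^')%classic).
    apply: near_eq_cvg; near=> h.
    rewrite !mxE eqxx /= addrK eq_sym /GRing.scale /= mulrA mulVf ?mul1r //.
    by near: h; exact: nbhs_dnbhs_neq.
  exact: cvg_cst.
apply: DeriveDef; last exact: cvg_lim H.
by apply/cvg_ex; exists (i == j)%:R.
Unshelve. all: by end_near. Qed.

Lemma is_partial_scalar i (phi : V -> R) x (dphi : R) (c : Cl) :
  is_derive x (delta_mx 0 i : V) (phi : V -> R^o) dphi ->
  is_partial i (fun y => phi y *: c) x (dphi *: c).
Proof.
move=> h A; rewrite clZE mulrC.
rewrite (_ : (fun y : V => (phi y *: c) A) = c A \*: (phi : V -> R^o)).
  exact: is_deriveZ.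
by apply/funext => y; rewrite clZE mulrC.
Qed.

Lemma is_partial_coord i j x (c : Cl) :
  is_partial i (fun y : V => y 0 j *: c) x ((i == j)%:R *: c).
Proof. exact: is_partial_scalar (is_derive_coord _ _ _). Qed.

End PartialDerivatives.

(** * Algebra of Q and its invertibility *)

Section KernelAlgebra.
Variables (R : realType) (n : nat) (s : 'rV[R]_n.+1).
Local Notation Cl := (clifford R n).
Local Notation V := 'rV[R]_n.+1.
Implicit Types (x y : V) (i : 'I_n) (k l : nat).

(** The square of [vector_norm], kept free of the square root so that it is polynomial in the
    coordinates. *)
Definition vecsq x : R := \sum_(i < n) x 0 (lift ord0 i) ^+ 2.

Lemma vecsq_ge0 x : 0 <= vecsq x.
Proof. by apply: sumr_ge0 => i _; exact: sqr_ge0. Qed.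

Lemma normsqE x : normsq x = x 0 0 ^+ 2 + vecsq x.
Proof. by rewrite /normsq big_ord_recl. Qed.

Lemma cl_gen_sq i : cl_gen R i * cl_gen R i = -1.
Proof.
have := cl_gen_anticomm R i i; rewrite eqxx mulr1n -mulr2n -scaler_nat => e.
apply: (@scalerI _ Cl (2 : R)); first by rewrite pnatr_eq0.
by rewrite e scaleNr scalerN.
Qed.

Lemma vector_part_sq x : vector_part x * vector_part x = (- vecsq x)%:A.
Proof.
apply: (@scalerI _ Cl (2 : R)); first by rewrite pnatr_eq0.
have -> : vector_part x * vector_part x = \sum_i \sum_j
    (x 0 (lift ord0 i) * x 0 (lift ord0 j)) *: (cl_gen R i * cl_gen R j).
  rewrite mulr_suml; apply: eq_bigr => i _.
  rewrite mulr_sumr; apply: eq_bigr => j _.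
  by rewrite -scalerAl -scalerAr scalerA.
(* Of the two copies of the double sum one gets its indices exchanged; the terms (i, j) and (j, i)
   then meet in an anticommutator, which vanishes off the diagonal. *)
rewrite -[2]/(1 + 1) scalerDl scale1r [X in _ + X]exchange_big -big_split /=.
have -> : (1 + 1 : R) *: (- vecsq x)%:A = \sum_i (- 2 * x 0 (lift ord0 i) ^+ 2)%:A :> Cl.
  rewrite -scaler_suml scalerA -mulr_sumr; congr (_ *: _); rewrite /vecsq; ring.
apply: eq_bigr => i _; rewrite -big_split /= (bigD1 i) //= big1 ?addr0.
  by rewrite -scalerDr cl_gen_anticomm eqxx mulr1n scalerA mulrC -expr2.
move=> j ji; rewrite mulrC -scalerDr cl_gen_anticomm eq_sym (negPf ji).
by rewrite mulr0n scale0r scaler0.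
Qed.

Definition slice_shift x : Cl := paravector s - (x 0 0)%:A.

Lemma paravector_sub_conj x :
  paravector s - para_conj x = slice_shift x + vector_part x.
Proof. by rewrite /slice_shift /para_conj opprB addrA addrAC. Qed.

Lemma slice_shiftE x : slice_shift x = (s 0 0 - x 0 0)%:A + vector_part s.
Proof. by rewrite /slice_shift /paravector scalerBl addrAC. Qed.

Lemma QcE x : Qc s x = slice_shift x * slice_shift x + (vecsq x)%:A.
Proof.
rewrite /Qc /slice_shift normsqE expr2 mulrBr !mulrBl -!scalerAl -!scalerAr !mul1r !mulr1.
cl_ring.
Qed.

(** This places Q in the commutative subalgebra spanned by 1 and the vector part of s, whose square
    is a nonpositive real. There Q behaves like a complex number, with conjugate [Qc_conj] and
    squared modulus [Qc_norm]. *)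
Lemma QcE2 x : Qc s x =
  ((s 0 0 - x 0 0) ^+ 2 + vecsq x - vecsq s)%:A
  + (2 * (s 0 0 - x 0 0)) *: vector_part s.
Proof.
rewrite QcE slice_shiftE mulrDr !mulrDl vector_part_sq -!scalerAl -!scalerAr !mul1r !mulr1.
cl_ring.
Qed.

Definition Qc_conj x : Cl :=
  ((s 0 0 - x 0 0) ^+ 2 + vecsq x - vecsq s)%:A
  - (2 * (s 0 0 - x 0 0)) *: vector_part s.

Definition Qc_norm x : R :=
  ((s 0 0 - x 0 0) ^+ 2 + vecsq x - vecsq s) ^+ 2
  + (2 * (s 0 0 - x 0 0)) ^+ 2 * vecsq s.

Lemma Qc_mul_conj x :
  Qc s x * Qc_conj x = (Qc_norm x)%:A /\ Qc_conj x * Qc s x = (Qc_norm x)%:A.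
Proof.
rewrite QcE2 /Qc_conj; have := erefl (Qc_norm x); rewrite {2}/Qc_norm.
set u := (_ - vecsq s); set v := 2 * _.
move: (Qc_norm x) u v => N u v NE.
split.
  rewrite mulrBr !mulrDl -!scalerAl -!scalerAr !mul1r !mulr1 vector_part_sq NE.
  by cl_ring.
rewrite mulrDr !mulrBl -!scalerAl -!scalerAr !mul1r !mulr1 vector_part_sq NE.
by cl_ring.
Qed.

Lemma Qc_unit x : Qc_norm x != 0 -> Qc s x \is a GRing.unit.
Proof.
move=> N0; have [h1 h2] := Qc_mul_conj x.
apply/unitrP; exists ((Qc_norm x)^-1 *: Qc_conj x); split.
  by rewrite -scalerAl h2 scalerA mulVf // scale1r.
by rewrite -scalerAr h1 scalerA mulVf // scale1r.
Qed.

Lemma Qc_inv x : Qc_norm x != 0 -> (Qc s x)^-1 = (Qc_norm x)^-1 *: Qc_conj x.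
Proof.
move=> N0; have [h1 h2] := Qc_mul_conj x.
apply: (mulrI (Qc_unit N0)); rewrite mulrV ?Qc_unit //.
by rewrite -scalerAr h1 scalerA mulVf // scale1r.
Qed.

(** If [Qc_norm] vanished, so would both of its nonnegative summands. With a = s_0 - x_0 this forces
    a = 0 and vector parts of s and x of equal length, which puts s on the sphere of x. *)
Lemma Qc_norm_neq0 x : (0 < n)%N ->
  ~ slice_sphere x (paravector s) -> Qc_norm x != 0.
Proof.
move=> n0 sx; apply/eqP => N0; apply: sx.
set a := s 0 0 - x 0 0 in N0.
have ge := vecsq_ge0; have := (ge x, ge s) => -[gx gs].
have h1 : a ^+ 2 + vecsq x - vecsq s = 0.
  by move: N0; rewrite /Qc_norm -/a; nra.
have h2 : a ^+ 2 * vecsq s = 0.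
  by move: N0; rewrite /Qc_norm -/a h1; nra.
have a0 : a = 0.
  move/eqP: h2; rewrite mulf_eq0 expf_eq0 /= => /orP[/eqP //|/eqP s0].
  by move: h1; rewrite s0; nra.
have vv : vecsq x = vecsq s by move: h1; rewrite a0; nra.
have s0 : s 0 0 = x 0 0 by apply/eqP; rewrite -subr_eq0 -/a a0.
pose rr := vector_norm x.
have rrE : rr ^+ 2 = vecsq s by rewrite sqr_sqrtr ?vecsq_ge0.
rewrite /slice_sphere /=.
have [r0|rn0] := eqVneq rr 0.
  have s_0 : vecsq s = 0 by rewrite -rrE r0 expr0n.
  have vs0 : vector_part s = 0.
    apply: big1 => i _; move/eqP: s_0; rewrite psumr_eq0 => [|j _]; last exact: sqr_ge0.
    move=> /allP/(_ i); rewrite mem_index_enum => /(_ isT).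
    by rewrite sqrf_eq0 => /eqP ->; rewrite scale0r.
  (* The sphere is a single point here, represented by any unit 1-vector J; [0 < n] supplies the
     first generator. *)
  pose i0 := Ordinal n0.
  exists (cl_gen R i0); last by rewrite -/rr r0 scale0r addr0 /paravector vs0 addr0 s0.
  exists (delta_mx 0 i0); split.
    rewrite (bigD1 i0) //= big1 ?addr0 ?mxE ?eqxx ?expr1n //.
    by move=> j ji; rewrite mxE (negPf ji) andbF expr0n.
  rewrite (bigD1 i0) //= big1 ?addr0 ?mxE ?eqxx ?scale1r //.
  by move=> j ji; rewrite mxE (negPf ji) andbF scale0r.
exists (rr^-1 *: vector_part s); last first.
  by rewrite -/rr scalerA mulfV // scale1r /paravector s0.
exists (\row_i (rr^-1 * s 0 (lift ord0 i))); split.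
  under eq_bigr do rewrite mxE exprMn.
  by rewrite -mulr_sumr -/(vecsq s) -rrE exprVn mulVf // expf_eq0.
rewrite scaler_sumr; apply: eq_bigr => i _; by rewrite mxE scalerA.
Qed.

End KernelAlgebra.

(** * Differentiability of Q and of its inverse *)

Section KernelCalculus.
Variables (R : realType) (n : nat) (s : 'rV[R]_n.+1).
Local Notation Cl := (clifford R n).
Local Notation V := 'rV[R]_n.+1.
Local Notation t := (slice_shift s).
Local Notation X := (@vector_part R n).
Local Notation Q := (Qc s).
Implicit Types (x y : V) (i : 'I_n) (k l : nat).

Lemma cvg_vecsq (F : set_system V) (FF : Filter F) x :
  (forall j, ((fun y : V => y 0 j) @ F --> x 0 j)%classic) ->
  (vecsq y @[y --> F] --> vecsq x)%classic.
Proof.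
move=> Fx; rewrite /vecsq; elim: (index_enum _) => [|i r IH].
  rewrite big_nil (_ : (fun y : V => _) = fun=> 0); first exact: cvg_cst.
  by apply/funext => y; rewrite big_nil.
rewrite big_cons (_ : (fun y : V => _) = (fun y : V => y 0 (lift ord0 i) * y 0 (lift ord0 i) +
    \sum_(k <- r) y 0 (lift ord0 k) ^+ 2)).
  by rewrite expr2; exact: (cvgD (cvgM (Fx (lift ord0 i)) (Fx (lift ord0 i))) IH).
by apply/funext => y; rewrite big_cons expr2.
Qed.

Lemma cvg_Qc_norm (F : set_system V) (FF : Filter F) x :
  (forall j, ((fun y : V => y 0 j) @ F --> x 0 j)%classic) ->
  (Qc_norm s y @[y --> F] --> Qc_norm s x)%classic.
Proof.
move=> Fx.
have c0 : ((fun y : V => s 0 0 - y 0 0) @ F --> (s 0 0 - x 0 0))%classic.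
  by apply: (cvgB _ (Fx _)); exact: cvg_cst.
rewrite /Qc_norm !expr2 (_ : (fun y : V => _) = (fun y : V =>
    ((s 0 0 - y 0 0) * (s 0 0 - y 0 0) + vecsq y - vecsq s) *
    ((s 0 0 - y 0 0) * (s 0 0 - y 0 0) + vecsq y - vecsq s) +
    (2 * (s 0 0 - y 0 0)) * (2 * (s 0 0 - y 0 0)) * vecsq s)); last first.
  by apply/funext => y; rewrite !expr2.
have c1 : ((fun y : V => (s 0 0 - y 0 0) * (s 0 0 - y 0 0) + vecsq y - vecsq s) @ F -->
    ((s 0 0 - x 0 0) * (s 0 0 - x 0 0) + vecsq x - vecsq s))%classic.
  apply: cvgB; last exact: cvg_cst.
  exact: (cvgD (cvgM c0 c0) (cvg_vecsq _ Fx)).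
apply: (cvgD (cvgM c1 c1)).
apply: cvgM; last exact: cvg_cst.
by apply: cvgM; apply: (cvgM _ c0); exact: cvg_cst.
Qed.

(** Openness of this condition lets formulas proved where [Qc_norm] is nonzero hold near x, hence be
    differentiated again. *)
Lemma near_Qc_norm_neq0 x : Qc_norm s x != 0 -> \forall y \near x, Qc_norm s y != 0.
Proof.
move=> N0; have := @cvg_Qc_norm (nbhs x) (nbhs_filter x) x.
move=> /(_ (fun j => @coord_continuous R 1 n.+1 0 j x)) /cvgr_neq0; exact.
Qed.

Lemma is_partial_slice_shift (i : 'I_n.+1) x : is_partial i t x (- (i == ord0)%:R%:A).
Proof.
have -> : t = fun y : V => paravector s + -1 *: (y 0 0 *: 1).
  by apply/funext => y; rewrite scaleN1r.
apply: is_partial_eq; first by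
  apply: is_partialD; [exact: is_partial_cst|apply: is_partialZ; exact: is_partial_coord].
by rewrite add0r scaleN1r.
Qed.

Lemma is_partial_vector_part0 x : is_partial ord0 X x 0.
Proof.
apply: is_partial_eq; first by apply: is_partial_sum => i; exact: is_partial_coord.
by rewrite big1 // => i _; rewrite scale0r.
Qed.

Lemma is_partial_vector_part i x : is_partial (lift ord0 i) X x (cl_gen R i).
Proof.
apply: is_partial_eq; first by apply: is_partial_sum => j; exact: is_partial_coord.
rewrite (bigD1 i) //= big1 ?addr0 ?eqxx ?scale1r // => j ji.
by rewrite (inj_eq (lift_inj (h := ord0))) eq_sym (negPf ji) scale0r.
Qed.

Definition dQc (j : 'I_n.+1) x : Cl :=
  if j == ord0 then - 2 *: t x else (2 * x 0 j)%:A.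

Lemma is_partial_Qc (j : 'I_n.+1) x : is_partial j Q x (dQc j x).
Proof.
have -> : Q = fun y : V => t y * t y +
    \sum_(i < n) (y 0 (lift ord0 i) *: 1) * (y 0 (lift ord0 i) *: 1).
  apply/funext => y; rewrite QcE /vecsq scaler_suml; congr (_ + _).
  by apply: eq_bigr => i _; rewrite -scalerAl mul1r scalerA expr2.
apply: is_partial_eq.
  apply: is_partialD; first by apply: is_partialM; exact: is_partial_slice_shift.
  by apply: is_partial_sum => i; apply: is_partialM; exact: is_partial_coord.
rewrite /dQc; case: (unliftP ord0 j) => [i|] ->.
  rewrite (bigD1 i) //= big1 ?addr0 => [|k ki].
    rewrite eqxx !scale1r scale0r oppr0 mul0r mulr0 !add0r cl_mul1r cl_mulr1.
    by cl_ring.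
  rewrite (inj_eq (lift_inj (h := ord0))) eq_sym (negPf ki).
  by rewrite !scale0r mul0r mulr0 addr0.
rewrite big1 => [|i _]; last by rewrite !scale0r mul0r mulr0 addr0.
rewrite eqxx !scale1r mulNr mulrN cl_mul1r cl_mulr1 addr0.
by cl_ring.
Qed.

(** Differentiability comes from Q^(-1) = [Qc_norm]^(-1) [Qc_conj], where only a real function is
    inverted; the value then follows by differentiating Q Q^(-1) = 1. *)
Lemma is_partial_Qc_inv (j : 'I_n.+1) x : Qc_norm s x != 0 ->
  is_partial j (fun y => (Q y)^-1) x (- ((Q x)^-1 * dQc j x * (Q x)^-1)).
Proof.
move=> N0.
have [dC hC] : exists dC, is_partial j (Qc_conj s) x dC.
  (* The conjugate is Q minus 4 (s_0 - x_0) times the vector part of s, a term affine in x. *)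
  have -> : Qc_conj s = fun y : V => Q y +
      (4 *: (y 0 0 *: vector_part s) + (- 4 * s 0 0) *: vector_part s).
    apply/funext => y; rewrite QcE2 /Qc_conj.
    by cl_ring.
  eexists; apply: is_partialD; first exact: is_partial_Qc.
  apply: is_partialD; last exact: is_partial_cst.
  by apply: is_partialZ; exact: is_partial_coord.
have [dN hN] : exists dN, is_derive x (delta_mx 0 j : V) (Qc_norm s : V -> R^o) dN.
  (* [Qc_norm] is the coordinate at the empty set of Q [Qc_conj], so the product rule already
     differentiates it. *)
  have := is_partialM (is_partial_Qc j x) hC => /(_ finset.set0).
  set dN := (_ : Cl) finset.set0 => hN; exists dN; move: hN; congr is_derive.
  apply/funext => y; have [-> _] := Qc_mul_conj s y.
  by rewrite clZE ffunE eqxx mulr1.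
have [dq hq] : exists dq, is_partial j (fun y => (Q y)^-1) x dq.
  have hV : is_derive x (delta_mx 0 j : V) (fun y : V => (Qc_norm s y)^-1 : R^o)
      (- (Qc_norm s x) ^- 2 *: dN).
    have [dvN vN] := hN.
    by apply: DeriveDef; [exact: derivableV|rewrite deriveV // vN].
  eexists; apply: is_partial_near; last first.
    by apply: is_partialM hC; exact: (is_partial_scalar 1 hV).
  near=> y; rewrite /= Qc_inv -?scalerAl ?mul1r //.
  by near: y; exact: near_Qc_norm_neq0.
apply: is_partial_eq; first exact: hq.
have hQq : is_partial j (fun y => Q y * (Q y)^-1) x 0.
  apply: is_partial_near; last exact: (@is_partial_cst _ _ _ 1).
  near=> y; rewrite mulrV //; apply: Qc_unit.
  by near: y; exact: near_Qc_norm_neq0.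
have e : dQc j x * (Q x)^-1 + Q x * dq = 0.
  by rewrite -(partial_derivE (is_partialM (is_partial_Qc j x) hq)) (partial_derivE hQq).
apply: (mulrI (Qc_unit N0)); rewrite mulrN !mulrA mulrV ?Qc_unit // mul1r.
by apply/eqP; rewrite -subr_eq0 opprK addrC e.
Unshelve. all: by end_near. Qed.


End KernelCalculus.

(** * The Dirac and Laplace operators on M(k, l) and E(k, l) *)

Section KernelMonomials.
Variables (R : realType) (n : nat) (s : 'rV[R]_n.+1).
Local Notation Cl := (clifford R n).
Local Notation V := 'rV[R]_n.+1.
Local Notation t := (slice_shift s).
Local Notation X := (@vector_part R n).
Local Notation Q := (Qc s).
Implicit Types (x y : V) (i : 'I_n) (k l : nat).

(** Commutation of [f x] with its derivative lets the factors be collected as in the real case; at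
    [k = 0] the exponent [k.-1] is harmless because the scalar is 0. *)
Lemma is_partialX (j : 'I_n.+1) (f : V -> Cl) x (df : Cl) k :
  GRing.comm (f x) df -> is_partial j f x df ->
  is_partial j (fun y => f y ^+ k) x (k%:R *: (f x ^+ k.-1 * df)).
Proof.
move=> fc hf; elim: k => [|k IH].
  by rewrite scale0r; apply: is_partial_cst.
rewrite (_ : (fun y => _) = fun y => f y ^+ k * f y); last first.
  by apply/funext => y; rewrite exprSr.
apply: is_partial_eq; first exact: is_partialM IH hf.
rewrite -scalerAl -mulrA -fc mulrA -exprSr -natr1 scalerDl scale1r.
by case: k {IH} => [|k]; rewrite ?scale0r // !scale0r.
Qed.

Lemma comm_slice_shift_Qc x : GRing.comm (t x) (Q x).
Proof.
rewrite QcE; apply: commrD; first by apply: commrM.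
by rewrite /GRing.comm -scalerAl -scalerAr mul1r mulr1.
Qed.

Lemma comm_slice_shift_Qc_inv x : GRing.comm (t x) (Q x)^-1.
Proof. exact/commrV/comm_slice_shift_Qc. Qed.

(** This is M(k, l). In the rules below the index [l.-1] at [l = 0] always carries the coefficient
    0. *)
Definition kmon k l y : Cl := Qc_negpow s y k * t y ^+ l.

(* Unifying distinct products makes Rocq unfold the Clifford multiplication,
   hence the generalizations before [cl_ring]. *)
Ltac kmon_ring :=
  rewrite ?succnK;
  repeat match goal with |- context [@GRing.mul ?S ?f (kmon ?k ?l ?y)] =>
    generalize (@GRing.mul S f (kmon k l y)); intro end;
  repeat match goal with |- context [kmon ?k ?l ?y] =>
    generalize (kmon k l y); intro end;
  cl_ring.

Lemma kmonS k l x : kmon k l.+1 x = t x * kmon k l x.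
Proof.
rewrite /kmon exprS !mulrA; congr (_ * _); apply/esym.
exact/commrX/comm_slice_shift_Qc_inv.
Qed.

(** The relation |v|^2 = Q - t^2 trades a factor |v|^2 for a change of indices, so that derivatives
    are again combinations of M(k, l) and v M(k, l). *)
Lemma vecsq_kmon k l x : Qc_norm s x != 0 ->
  vecsq x *: kmon k.+1 l x = kmon k l x - kmon k.+1 l.+2 x.
Proof.
move=> N0; apply/eqP; rewrite eq_sym subr_eq; apply/eqP.
rewrite !kmonS mulrA -[vecsq x *: _]mul1r -scalerAr scalerAl -mulrDl addrC -QcE.
by rewrite /kmon /Qc_negpow exprS !mulrA mulrV ?mul1r // Qc_unit.
Qed.

Lemma is_partial_Qc_negpow0 k x : Qc_norm s x != 0 ->
  is_partial ord0 (fun y => Qc_negpow s y k) x ((2 * k%:R) *: (Qc_negpow s x k.+1 * t x)).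
Proof.
move=> N0; have tq := comm_slice_shift_Qc_inv x.
have dE : - ((Q x)^-1 * dQc s ord0 x * (Q x)^-1) = 2 *: ((Q x)^-1 * ((Q x)^-1 * t x)).
  by rewrite /dQc eqxx -scalerAr -scalerAl scaleNr opprK -mulrA tq.
apply: is_partial_eq.
  apply: is_partialX (is_partial_Qc_inv ord0 N0); rewrite dE /GRing.comm -scalerAr -scalerAl.
  by rewrite -!mulrA -tq.
rewrite dE -scalerAr scalerA mulrC /Qc_negpow.
by case: k => [|k]; [rewrite mulr0 !scale0r|rewrite /= !mulrA -!exprSr].
Qed.

Lemma is_partial_Qc_negpow k i x : Qc_norm s x != 0 ->
  is_partial (lift ord0 i) (fun y => Qc_negpow s y k) x
    ((- 2 * k%:R * x 0 (lift ord0 i)) *: Qc_negpow s x k.+1).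
Proof.
move=> N0.
have dE : - ((Q x)^-1 * dQc s (lift ord0 i) x * (Q x)^-1) =
    (- 2 * x 0 (lift ord0 i)) *: ((Q x)^-1 * (Q x)^-1).
  by rewrite /dQc /= -scalerAr -scalerAl mulr1 mulNr scaleNr.
apply: is_partial_eq.
  apply: is_partialX (is_partial_Qc_inv _ N0).
  by rewrite dE /GRing.comm -scalerAr -scalerAl mulrA.
rewrite dE -scalerAr scalerA mulrA [k%:R * _]mulrC /Qc_negpow.
by case: k => [|k]; [rewrite mulr0 mul0r !scale0r|rewrite /= !mulrA -!exprSr].
Qed.

Lemma is_partial_kmon0 k l x : Qc_norm s x != 0 ->
  is_partial ord0 (kmon k l) x ((2 * k%:R) *: kmon k.+1 l.+1 x - l%:R *: kmon k l.-1 x).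
Proof.
move=> N0; apply: is_partial_eq.
  apply: is_partialM; first exact: is_partial_Qc_negpow0.
  apply: is_partialX; last exact: is_partial_slice_shift.
  by rewrite eqxx scale1r; apply: commrN; exact: commr1.
rewrite eqxx scale1r mulrN1 scalerN mulrN -scalerAr -scalerAl.
by rewrite /kmon exprS mulrA.
Qed.

Lemma is_partial_kmon k l i x : Qc_norm s x != 0 ->
  is_partial (lift ord0 i) (kmon k l) x
    ((- 2 * k%:R * x 0 (lift ord0 i)) *: kmon k.+1 l x).
Proof.
move=> N0; apply: is_partial_eq.
  apply: is_partialM; first exact: is_partial_Qc_negpow.
  apply: is_partialX; last exact: is_partial_slice_shift.
  by rewrite scale0r oppr0; exact: commr0.
by rewrite scale0r oppr0 mulr0 scaler0 mulr0 addr0 -scalerAl.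
Qed.

Definition has_dirac (f : V -> Cl) x (g : Cl) :=
  exists2 G : 'I_n.+1 -> Cl, (forall j, is_partial j f x (G j)) &
    g = G ord0 + \sum_(i < n) cl_gen R i * G (lift ord0 i).

Lemma dirac_opE f x g : has_dirac f x g -> dirac_op f x = g.
Proof.
case=> G hG ->; rewrite /dirac_op (partial_derivE (hG _)); congr (_ + _).
by apply: eq_bigr => i _; rewrite (partial_derivE (hG _)).
Qed.

Lemma has_dirac_near f g x c :
  (\forall y \near x, f y = g y) -> has_dirac f x c -> has_dirac g x c.
Proof. by move=> fg [G hG ->]; exists G => // j; exact: is_partial_near fg (hG j). Qed.

Lemma has_diracD f g x c d :
  has_dirac f x c -> has_dirac g x d -> has_dirac (fun y => f y + g y) x (c + d).
Proof.
case=> F hF -> [G hG ->]; exists (fun j => F j + G j).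
  by move=> j; exact: is_partialD.
by rewrite addrACA -big_split /=; congr (_ + _); apply: eq_bigr => i _; rewrite mulrDr.
Qed.

Lemma has_diracZ a f x c : has_dirac f x c -> has_dirac (fun y => a *: f y) x (a *: c).
Proof.
case=> F hF ->; exists (fun j => a *: F j).
  by move=> j; exact: is_partialZ.
by rewrite scalerDr scaler_sumr; congr (_ + _); apply: eq_bigr => i _; rewrite scalerAr.
Qed.

Lemma has_dirac_sum (I : Type) (r : seq I) (F : I -> V -> Cl) x (dF : I -> Cl) :
  (forall a, has_dirac (F a) x (dF a)) ->
  has_dirac (fun y => \sum_(a <- r) F a y) x (\sum_(a <- r) dF a).
Proof.
move=> hF; elim: r => [|a r IH].
  exists (fun=> 0); last by rewrite big_nil big1 ?addr0 // => i _; rewrite mulr0.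
  move=> j; rewrite (_ : (fun _ => _) = (fun=> 0)); first exact: is_partial_cst.
  by apply/funext => y; rewrite big_nil.
rewrite big_cons (_ : (fun _ => _) = (fun y => F a y + \sum_(a <- r) F a y)).
  exact: has_diracD.
by apply/funext => y; rewrite big_cons.
Qed.

(** This is E(k, l); the Cauchy kernel is E(1, 0). *)
Definition skmon k l y : Cl := (paravector s - para_conj y) * kmon k l y.

Lemma skmonE k l y : skmon k l y = kmon k l.+1 y + X y * kmon k l y.
Proof. by rewrite /skmon paravector_sub_conj mulrDl -kmonS. Qed.

Lemma sum_gen_kmon (a : R) x (c : Cl) :
  \sum_(i < n) cl_gen R i * ((a * x 0 (lift ord0 i)) *: c) = a *: (X x * c).
Proof.
rewrite /vector_part mulr_suml scaler_sumr; apply: eq_bigr => i _.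
by rewrite -scalerAr -scalerAl scalerA.
Qed.

(** The spatial derivatives add up to -2k v M(k+1, l). Writing v M(k+1, l) as E(k+1, l) - M(k+1,
    l+1) doubles the coefficient 2k that comes from the derivative in x_0. *)
Lemma has_dirac_kmon k l x : Qc_norm s x != 0 ->
  has_dirac (kmon k l) x (- (2 * k%:R) *: skmon k.+1 l x
     + (4 * k%:R) *: kmon k.+1 l.+1 x - l%:R *: kmon k l.-1 x).
Proof.
move=> N0; exists (fun j => if unlift ord0 j is Some i
    then (- 2 * k%:R * x 0 (lift ord0 i)) *: kmon k.+1 l x
    else (2 * k%:R) *: kmon k.+1 l.+1 x - l%:R *: kmon k l.-1 x).
  move=> j; case: unliftP => [i|] ->; [exact: is_partial_kmon|exact: is_partial_kmon0].
rewrite unlift_none; under eq_bigr do rewrite liftK.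
rewrite sum_gen_kmon skmonE; kmon_ring.
Qed.

(** In the spatial part, the derivatives of v contribute -n M(k, l) since e_i^2 = -1, and those of
    M(k, l) contribute -2k v^2 M(k+1, l) = 2k |v|^2 M(k+1, l), which [vecsq_kmon] rewrites. *)
Lemma has_dirac_vector_kmon k l x : Qc_norm s x != 0 ->
  has_dirac (fun y => X y * kmon k l y) x
    ((2 * k%:R) *: (X x * kmon k.+1 l.+1 x) - l%:R *: (X x * kmon k l.-1 x)
     - n%:R *: kmon k l x + (2 * k%:R) *: (kmon k l x - kmon k.+1 l.+2 x)).
Proof.
move=> N0; exists (fun j => if unlift ord0 j is Some i
    then cl_gen R i * kmon k l x + X x * ((- 2 * k%:R * x 0 (lift ord0 i)) *: kmon k.+1 l x)
    else X x * ((2 * k%:R) *: kmon k.+1 l.+1 x - l%:R *: kmon k l.-1 x)).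
  move=> j; case: unliftP => [i|] ->.
    by apply: is_partialM; [exact: is_partial_vector_part|exact: is_partial_kmon].
  apply: is_partial_eq.
    by apply: is_partialM; [exact: is_partial_vector_part0|exact: is_partial_kmon0].
  by rewrite mul0r add0r.
rewrite unlift_none; rewrite (eq_bigr (fun i => - kmon k l x + cl_gen R i *
    ((- 2 * k%:R * x 0 (lift ord0 i)) *: (X x * kmon k.+1 l x)))) => [|i _]; last first.
  by rewrite liftK mulrDr [_ * (_ * kmon _ _ _)]mulrA cl_gen_sq mulN1r -[X x * _]scalerAr.
rewrite big_split /= sumr_const card_ord sum_gen_kmon mulrA vector_part_sq -scalerAl mul1r.
rewrite scaleNr vecsq_kmon // !cl_distrE -[- kmon k l x *+ _]scaler_nat.
kmon_ring.
Qed.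

(** In the sum of the two preceding formulas all terms with Q^(-k-1) cancel. *)
Lemma has_dirac_skmon k l x : Qc_norm s x != 0 ->
  has_dirac (skmon k l) x
    (- l%:R *: skmon k l.-1 x + (2 * k%:R - n%:R - 1) *: kmon k l x).
Proof.
move=> N0; apply: (@has_dirac_near (fun y => kmon k l.+1 y + X y * kmon k l y)).
  by near=> y; rewrite skmonE.
have := has_diracD (has_dirac_kmon k l.+1 N0) (has_dirac_vector_kmon k l N0).
congr has_dirac; rewrite !skmonE succnK.
(* The cases differ because [l.-1.+1] is [l] only for positive [l]. *)
by case: l => [|l]; kmon_ring.
Unshelve. all: by end_near. Qed.

Definition skmon_d0 k y : Cl :=
  (2 * k%:R) *: kmon k.+1 2 y - kmon k 0 y + (2 * k%:R) *: (X y * kmon k.+1 1 y).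

(** The coordinate appears as a multiple of 1 so that the summands are products of Clifford-valued
    functions and [is_partialM] applies again. *)
Definition skmon_d k i y : Cl :=
  (- (2 * k%:R)) *: (y 0 (lift ord0 i) *: 1 * kmon k.+1 1 y) + cl_gen R i * kmon k 0 y
  + (- (2 * k%:R)) *: (y 0 (lift ord0 i) *: 1 * (X y * kmon k.+1 0 y)).

Lemma is_partial_skmon0 k y : Qc_norm s y != 0 ->
  is_partial ord0 (skmon k 0) y (skmon_d0 k y).
Proof.
move=> N0; rewrite (_ : skmon k 0 = (fun y => kmon k 1 y + X y * kmon k 0 y)); last first.
  by apply/funext => z; rewrite skmonE.
apply: is_partial_eq.
  apply: is_partialD; first exact: is_partial_kmon0.
  by apply: is_partialM; [exact: is_partial_vector_part0|exact: is_partial_kmon0].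
rewrite /skmon_d0 mul0r add0r !cl_distrE.
kmon_ring.
Qed.

Lemma is_partial_skmon k i y : Qc_norm s y != 0 ->
  is_partial (lift ord0 i) (skmon k 0) y (skmon_d k i y).
Proof.
move=> N0; rewrite (_ : skmon k 0 = (fun y => kmon k 1 y + X y * kmon k 0 y)); last first.
  by apply/funext => z; rewrite skmonE.
apply: is_partial_eq.
  apply: is_partialD; first exact: is_partial_kmon.
  by apply: is_partialM; [exact: is_partial_vector_part|exact: is_partial_kmon].
rewrite /skmon_d !cl_distrE.
kmon_ring.
Qed.

Lemma is_partial_skmon_d0 k x : Qc_norm s x != 0 ->
  is_partial ord0 (skmon_d0 k) x
    ((4 * k%:R * k.+1%:R) *: kmon k.+2 3 x - (6 * k%:R) *: kmon k.+1 1 x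
     + (4 * k%:R * k.+1%:R) *: (X x * kmon k.+2 2 x)
     - (2 * k%:R) *: (X x * kmon k.+1 0 x)).
Proof.
move=> N0; rewrite (_ : skmon_d0 k = fun y => (2 * k%:R) *: kmon k.+1 2 y
    + -1 *: kmon k 0 y + (2 * k%:R) *: (X y * kmon k.+1 1 y)); last first.
  by apply/funext => y; rewrite scaleN1r.
apply: is_partial_eq.
  apply: is_partialD; first by
    apply: is_partialD; apply: is_partialZ; exact: is_partial_kmon0.
  apply: is_partialZ; apply: is_partialM; first exact: is_partial_vector_part0.
  exact: is_partial_kmon0.
rewrite mul0r add0r !cl_distrE.
kmon_ring.
Qed.

Lemma is_partial_skmon_d k i x : Qc_norm s x != 0 ->
  is_partial (lift ord0 i) (skmon_d k i) x
    (- (2 * k%:R) *: (kmon k.+1 1 x + X x * kmon k.+1 0 x)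
     + x 0 (lift ord0 i) ^+ 2 *: ((4 * k%:R * k.+1%:R) *: (kmon k.+2 1 x + X x * kmon k.+2 0 x))
     + cl_gen R i * ((- (4 * k%:R) * x 0 (lift ord0 i)) *: kmon k.+1 0 x)).
Proof.
move=> N0; apply: is_partial_eq.
  apply: is_partialD.
    apply: is_partialD.
      apply: is_partialZ; apply: is_partialM; first exact: is_partial_coord.
      exact: is_partial_kmon.
    apply: is_partialM; first exact: is_partial_cst.
    exact: is_partial_kmon.
  apply: is_partialZ; apply: is_partialM; first exact: is_partial_coord.
  by apply: is_partialM; [exact: is_partial_vector_part|exact: is_partial_kmon].
rewrite eqxx !scale1r mul0r add0r !cl_distrE.
kmon_ring.
Qed.

(** Summing second derivatives turns the x_i^2 into |v|^2, which [vecsq_kmon] absorbs. The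
    assumption on [f] is restricted to nonzero [Qc_norm], as this is all that an induction on
    iterated Laplacians supplies. *)
Lemma laplacian_skmon (a : R) (f : V -> Cl) k x :
  (forall y, Qc_norm s y != 0 -> f y = a *: skmon k 0 y) -> Qc_norm s x != 0 ->
  laplacian f x = (a * (2 * k%:R * (2 * k%:R - n%:R - 1))) *: skmon k.+1 0 x.
Proof.
move=> fE N0.
have d2E j (g : V -> Cl) c : (forall y, Qc_norm s y != 0 -> is_partial j (skmon k 0) y (g y)) ->
    is_partial j g x c -> partial_deriv j (partial_deriv j f) x = a *: c.
  move=> hg hc; apply: partial_derivE.
  apply: is_partial_near; last exact: is_partialZ hc.
  near=> y; apply/esym/partial_derivE.
  have Ny : Qc_norm s y != 0 by near: y; exact: near_Qc_norm_neq0.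
  apply: is_partial_near; last exact: is_partialZ (hg _ Ny).
  near=> z; rewrite fE //; near: z; exact: near_Qc_norm_neq0.
rewrite /laplacian big_ord_recl.
rewrite (d2E _ _ _ (@is_partial_skmon0 k) (is_partial_skmon_d0 k N0)).
rewrite (eq_bigr _ (fun i _ => d2E _ _ _ (@is_partial_skmon k i) (is_partial_skmon_d k i N0))).
rewrite -[X in _ + X]scaler_sumr -[LHS]scalerDr -[RHS]scalerA; congr (_ *: _).
have vE c : vecsq x *: (c *: (kmon k.+2 1 x + X x * kmon k.+2 0 x)) =
    c *: (kmon k.+1 1 x - kmon k.+2 3 x + X x * (kmon k.+1 0 x - kmon k.+2 2 x)).
  by rewrite -!vecsq_kmon // cl_scalerAr -scalerDr !scalerA mulrC.
rewrite !big_split /= sumr_const card_ord sum_gen_kmon -scaler_suml -/(vecsq x) vE.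
rewrite -[X in _ + (X + _ + _)]scaler_nat skmonE !cl_distrE -natr1; kmon_ring.
Unshelve. all: by end_near. Qed.

Lemma SL_kernelE x : SL_kernel s x = skmon 1 0 x.
Proof. by rewrite /SL_kernel /skmon /Qc_negpow /kmon expr0 mulr1. Qed.

(** Each step multiplies by 2(m+1)(2(m+1) - n - 1) = -4(m+1)(h - m), the quotient of consecutive
    values of [gamma_coef]. *)
Lemma iter_laplacian_SL_kernel h m x : n = (2 * h + 1)%N -> (m <= h)%N ->
  Qc_norm s x != 0 ->
  iter m (@laplacian R n) (SL_kernel s) x = gamma_coef R h m *: skmon m.+1 0 x.
Proof.
move=> nE; elim: m x => [|m IH] x mh N0.
  rewrite -[iter 0 _ _ x]/(SL_kernel s x) SL_kernelE /gamma_coef.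
  rewrite /pochhammer_neg subn0 !expr0 fact0 !mul1r divff ?scale1r //.
rewrite iterS (laplacian_skmon (fun y => IH y (ltnW mh)) N0); congr (_ *: _).
have [d hE] : exists d, h = (m + d.+1)%N by exists (h - m.+1)%N; lia.
rewrite /gamma_coef /pochhammer_neg nE hE.
have -> : (m + d.+1 - m = d.+1)%N by lia.
have -> : (m + d.+1 - m.+1 = d)%N by lia.
rewrite !exprS [in m.+1`!]factS [in d.+1`!]factS !natrM !natrD.
have d0 : (d`!%:R : R) != 0 by rewrite pnatr_eq0 -lt0n fact_gt0.
field.
by rewrite d0 nat1r pnatr_eq0.
Qed.

End KernelMonomials.

(** * Recurrences between the four families of coefficients *)

Section CoefficientRecurrences.
Variable R : realType.
Implicit Types h m k j d p : nat.

Lemma factR_neq0 k : (k`!%:R : R) != 0.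
Proof. by rewrite pnatr_eq0 -lt0n fact_gt0. Qed.

Lemma bin_fact_ratio a b c : c = (a + b)%N ->
  ('C(c, a))%:R = c`!%:R / (a`!%:R * b`!%:R) :> R.
Proof.
move=> ->; apply: (mulIf (mulf_neq0 (factR_neq0 a) (factR_neq0 b))).
rewrite divfK ?mulf_neq0 ?factR_neq0 // -!natrM; congr (_%:R).
by have := bin_fact (leq_addr b a); rewrite addKn => ->.
Qed.

(** With d = k - j - 1 and p = h - m - 2k - 1 no truncated subtraction is left, and d! cancels
    against the denominator of the first binomial coefficient. The other families are treated alike,
    with d = k - j for [coef_b1] and p = h - m - 2k for [coef_a2] and [coef_b2]. *)
Lemma coef_a1E h m k j d p : k = (j + d).+1 -> h = (m + 2 * k + 1 + p)%N ->
  coef_a1 R h m k j = 2 ^+ (2 * j).+1 * (m + 2 * j + d).+2`!%:R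
    * ((2 * j + d).+1`!%:R / (2 * j).+1`!%:R) * ((p + d)`!%:R / (p`!%:R * d`!%:R)).
Proof.
move=> kE hE; rewrite /coef_a1.
have -> : (h - m - k - j - 2 = p + d)%N by lia.
have -> : (h - m - 2 * k - 1 = p)%N by lia.
have -> : (k + j = (2 * j + d).+1)%N by lia.
have -> : (k - j - 1 = d)%N by lia.
have -> : (m + k + 1 + j = (m + 2 * j + d).+2)%N by lia.
have -> : (2 * j + 1 = (2 * j).+1)%N by lia.
rewrite 4!natrM natrX (@bin_fact_ratio (2 * j).+1 d) // (@bin_fact_ratio p d) //.
by field; rewrite !factR_neq0.
Qed.

Lemma coef_b1E h m k j d p : k = (j + d)%N -> h = (m + 2 * k + 1 + p)%N ->
  coef_b1 R h m k j = 2 ^+ (2 * j) * (m + 2 * j + d)`!%:R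
    * ((2 * j + d)`!%:R / (2 * j)`!%:R) * ((p + d)`!%:R / (p`!%:R * d`!%:R)).
Proof.
move=> kE hE; rewrite /coef_b1.
have -> : (h - m - k - j - 1 = p + d)%N by lia.
have -> : (h - m - 2 * k - 1 = p)%N by lia.
have -> : (k - j = d)%N by lia.
have -> : (m + k + j = m + 2 * j + d)%N by lia.
have -> : (k + j = 2 * j + d)%N by lia.
rewrite 4!natrM natrX (@bin_fact_ratio (2 * j) d) // (@bin_fact_ratio p d) //.
by field; rewrite !factR_neq0.
Qed.

Lemma coef_a2E h m k j d p : k = (j + d).+1 -> h = (m + 2 * k + p)%N ->
  coef_a2 R h m k j = 2 ^+ (2 * j) * (m + 2 * j + d).+1`!%:R
    * ((2 * j + d)`!%:R / (2 * j)`!%:R) * ((p + d)`!%:R / (p`!%:R * d`!%:R)).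
Proof.
move=> kE hE; rewrite /coef_a2.
have -> : (h - m - k - 1 - j = p + d)%N by lia.
have -> : (h - m - 2 * k = p)%N by lia.
have -> : (k - j - 1 = d)%N by lia.
have -> : (m + k + j = (m + 2 * j + d).+1)%N by lia.
have -> : (k + j - 1 = 2 * j + d)%N by lia.
rewrite 4!natrM natrX (@bin_fact_ratio (2 * j) d) // (@bin_fact_ratio p d) //.
by field; rewrite !factR_neq0.
Qed.

Lemma coef_b2E h m k j d p : k = (j + d).+1 -> h = (m + 2 * k + p)%N ->
  coef_b2 R h m k j = 2 ^+ (2 * j).+1 * (m + 2 * j + d).+1`!%:R
    * ((2 * j + d).+1`!%:R / (2 * j).+1`!%:R) * ((p + d)`!%:R / (p`!%:R * d`!%:R)).
Proof.
move=> kE hE; rewrite /coef_b2.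
have -> : (h - m - k - 1 - j = p + d)%N by lia.
have -> : (h - m - 2 * k = p)%N by lia.
have -> : (k - j - 1 = d)%N by lia.
have -> : (m + k + j = (m + 2 * j + d).+1)%N by lia.
have -> : (k + j = (2 * j + d).+1)%N by lia.
have -> : (2 * j + 1 = (2 * j).+1)%N by lia.
rewrite 4!natrM natrX (@bin_fact_ratio (2 * j).+1 d) // (@bin_fact_ratio p d) //.
by field; rewrite !factR_neq0.
Qed.

(** Vanishing outside the summation range allows sums to be lengthened and settles the boundary
    cases of the recurrences. *)
Lemma coef_a1_out h m k j : (k <= j)%N -> coef_a1 R h m k j = 0.
Proof. by move=> kj; rewrite /coef_a1 [X in (_ * X * _)%N]bin_small ?muln0 ?mul0n //; lia. Qed.

Lemma coef_b1_out h m k j : (k < j)%N -> coef_b1 R h m k j = 0.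
Proof. by move=> kj; rewrite /coef_b1 [X in (_ * X)%N]bin_small ?muln0 //; lia. Qed.

(** At [k = j = 0] truncation gives [k + j - 1 = 0], and ['C(0, 0)] is 1; hence the condition
    [0 < k]. *)
Lemma coef_a2_out h m k j : (0 < k)%N -> (k <= j)%N -> coef_a2 R h m k j = 0.
Proof. by move=> k0 kj; rewrite /coef_a2 [X in (_ * X * _)%N]bin_small ?muln0 ?mul0n //; lia. Qed.

Lemma coef_b2_out h m k j : (k <= j)%N -> coef_b2 R h m k j = 0.
Proof. by move=> kj; rewrite /coef_b2 [X in (_ * X)%N]bin_small ?muln0 //; lia. Qed.

(** Factorials and powers of successors are expanded down to common ones, which leaves an identity
    of rational functions with nonzero denominators. *)
Ltac fact_field :=
  rewrite ?muln0 ?addn0 ?add0n ?mulnS ?add2n ?addnS ?addSn ?factS ?fact0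
    ?natrM ?exprS -?natr1 ?natrD ?natrM;
  field; rewrite ?factR_neq0 -?natrM -?natrD ?nat1r ?natr1 -?natrD ?pnatr_eq0 //.

(** Compares the coefficients of E(m+2+k+j, 2j+1) in D [even_sum k] = 2 [odd_sum k]. *)
Lemma coef_a1_rec h m k j : (j < k)%N -> (m + 2 * k + 1 <= h)%N ->
  2 * coef_a1 R h m k j =
    - (2 * j.+1)%:R * coef_a2 R h m k j.+1 + 2 * (m + 1 + k + j)%:R * coef_b2 R h m k j.
Proof.
move=> jk kh.
have [p hE] : exists p, h = (m + 2 * k + 1 + p)%N by exists (h - (m + 2 * k + 1))%N; lia.
have hE2 : h = (m + 2 * k + p.+1)%N by lia.
have [d kE] : exists d, k = (j + d).+1 by exists (k - j.+1)%N; lia.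
rewrite (coef_a1E kE hE) (coef_b2E kE hE2).
(* For d = 0 the index j + 1 = k is out of range for [coef_a2], and [coef_a2E] does not apply. *)
case: d kE => [|d] kE.
  rewrite coef_a2_out; [|lia..]; rewrite kE; fact_field.
have kE' : k = (j.+1 + d).+1 by lia.
rewrite (coef_a2E kE' hE2) kE; fact_field.
Qed.

(** Concerns M(m+1+k, 0), to which no [coef_b2] of smaller index contributes, unlike the other M in
    the same identity. *)
Lemma coef_b1_rec0 h m k : (0 < k)%N -> (m + 2 * k + 1 <= h)%N ->
  2 * coef_b1 R h m k 0 =
    (2 * h%:R - 2 * (m + k)%:R) * coef_a2 R h m k 0 - coef_b2 R h m k 0.
Proof.
move=> k0 kh.
have [p hE] : exists p, h = (m + 2 * k + 1 + p)%N by exists (h - (m + 2 * k + 1))%N; lia.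
have hE2 : h = (m + 2 * k + p.+1)%N by lia.
have hR : h%:R = m%:R + 2 * k%:R + 1 + p%:R :> R by rewrite hE 3!natrD natrM.
have [d kE] : exists d, k = (0 + d).+1 by exists k.-1; lia.
have kE' : k = (0 + d.+1)%N by lia.
rewrite (coef_b1E kE' hE) (coef_a2E kE hE2) (coef_b2E kE hE2) hR kE; fact_field.
Qed.

Lemma coef_b1_rec h m k j : (j < k)%N -> (m + 2 * k + 1 <= h)%N ->
  2 * coef_b1 R h m k j.+1 =
    (2 * h%:R - 2 * (m + k + j.+1)%:R) * coef_a2 R h m k j.+1
    + 4 * (m + 1 + k + j)%:R * coef_b2 R h m k j
    - (2 * j.+1 + 1)%:R * coef_b2 R h m k j.+1.
Proof.
move=> jk kh.
have [p hE] : exists p, h = (m + 2 * k + 1 + p)%N by exists (h - (m + 2 * k + 1))%N; lia.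
have hE2 : h = (m + 2 * k + p.+1)%N by lia.
have hR : h%:R = m%:R + 2 * k%:R + 1 + p%:R :> R by rewrite hE 3!natrD natrM.
have [d kE] : exists d, k = (j + d).+1 by exists (k - j.+1)%N; lia.
have kE1 : k = (j.+1 + d)%N by lia.
rewrite (coef_b1E kE1 hE) (coef_b2E kE hE2).
case: d kE kE1 => [|d] kE kE1.
  rewrite coef_a2_out ?coef_b2_out; [|lia..]; rewrite hR kE; fact_field.
have kE' : k = (j.+1 + d).+1 by lia.
rewrite (coef_a2E kE' hE2) (coef_b2E kE' hE2) hR kE; fact_field.
Qed.

(** Compares the coefficients of E(m+2+k+j, 2j) in D [odd_sum k] = 2 [even_sum k.+1]; [coef_b2_rec]
    does so for M(m+2+k+j, 2j+1). *)
Lemma coef_a2_rec h m k j : (j <= k)%N -> (m + 2 * k + 2 <= h)%N ->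
  2 * coef_a2 R h m k.+1 j =
    - (2 * j + 1)%:R * coef_a1 R h m k j + 2 * (m + 1 + k + j)%:R * coef_b1 R h m k j.
Proof.
move=> jk kh.
have [p hE] : exists p, h = (m + 2 * k.+1 + p)%N by exists (h - (m + 2 * k.+1))%N; lia.
have hE1 : h = (m + 2 * k + 1 + p.+1)%N by lia.
have [d kE] : exists d, k = (j + d)%N by exists (k - j)%N; lia.
have kE1 : k.+1 = (j + d).+1 by lia.
rewrite (coef_a2E kE1 hE) (coef_b1E kE hE1).
case: d kE kE1 => [|d] kE kE1.
  rewrite coef_a1_out; [|lia..]; rewrite kE; fact_field.
have kE' : k = (j + d).+1 by lia.
rewrite (coef_a1E kE' hE1) kE; fact_field.
Qed.

Lemma coef_b2_rec h m k j : (j <= k)%N -> (m + 2 * k + 2 <= h)%N ->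
  2 * coef_b2 R h m k.+1 j =
    (2 * h%:R - 2 * (m + 1 + k + j)%:R) * coef_a1 R h m k j
    + 4 * (m + 1 + k + j)%:R * coef_b1 R h m k j
    - (2 * j.+1)%:R * coef_b1 R h m k j.+1.
Proof.
move=> jk kh.
have [p hE] : exists p, h = (m + 2 * k.+1 + p)%N by exists (h - (m + 2 * k.+1))%N; lia.
have hE1 : h = (m + 2 * k + 1 + p.+1)%N by lia.
have hR : h%:R = m%:R + 2 * k%:R + 2 + p%:R :> R.
  by rewrite hE 2!natrD natrM -natr1; ring.
have [d kE] : exists d, k = (j + d)%N by exists (k - j)%N; lia.
have kE1 : k.+1 = (j + d).+1 by lia.
rewrite (coef_b2E kE1 hE) (coef_b1E kE hE1).
case: d kE kE1 => [|d] kE kE1.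
  rewrite coef_a1_out ?coef_b1_out; [|lia..]; rewrite kE; fact_field.
have kE' : k = (j + d).+1 by lia.
have kE2 : k = (j.+1 + d)%N by lia.
rewrite (coef_a1E kE' hE1) (coef_b1E kE2 hE1) hR kE; fact_field.
Qed.

End CoefficientRecurrences.

(** * Iteration of the Dirac operator *)

Section DiracIteration.
Variables (R : realType) (n h m : nat) (s : 'rV[R]_n.+1).
Hypothesis nE : n = (2 * h + 1)%N.
Local Notation Cl := (clifford R n).
Local Notation V := 'rV[R]_n.+1.
Local Notation E := (skmon s).
Local Notation M := (kmon s).
Local Notation a1 := (coef_a1 R h m).
Local Notation b1 := (coef_b1 R h m).
Local Notation a2 := (coef_a2 R h m).
Local Notation b2 := (coef_b2 R h m).
Implicit Types (x y : V) (k j : nat).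

(** The bracket of case (i), with s - conj x moved inside the sum and the subtraction written as a
    scaling to suit [has_diracZ]; [even_sum] is that of case (ii). *)
Definition odd_sum k y : Cl :=
  \sum_(0 <= j < k) a1 k j *: E (m + j + 2 + k) (2 * j + 1) y
  + -1 *: \sum_(0 <= j < k.+1) b1 k j *: M (m + 1 + k + j) (2 * j) y.

Definition even_sum k y : Cl :=
  \sum_(0 <= j < k) a2 k j *: E (m + j + 1 + k) (2 * j) y
  + -1 *: \sum_(0 <= j < k) b2 k j *: M (m + 1 + k + j) (2 * j + 1) y.

(** Aligns terms whose indices D has shifted by one, without changing the range. *)
Lemma sum_recl_last0 (W : zmodType) (F : nat -> W) k :
  F k = 0 -> \sum_(0 <= j < k) F j = F 0%N + \sum_(0 <= j < k) F j.+1.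
Proof. by move=> F0; rewrite -big_nat_recl // big_nat_recr //= F0 addr0. Qed.

Lemma has_dirac_even_sum k x : (0 < k)%N -> (m + 2 * k + 1 <= h)%N ->
  Qc_norm s x != 0 -> has_dirac (even_sum k) x (2 *: odd_sum k x).
Proof.
move=> k0 kh N0.
have H := has_diracD
  (has_dirac_sum (index_iota 0 k) (fun j =>
    has_diracZ (a2 k j) (has_dirac_skmon (m + j + 1 + k) (2 * j) N0)))
  (has_diracZ (-1) (has_dirac_sum (index_iota 0 k) (fun j =>
    has_diracZ (b2 k j) (has_dirac_kmon (m + 1 + k + j) (2 * j + 1) N0)))).
move: H; congr has_dirac.
(* The terms of D by type: [u] and [v] carry E, [g] and [w] carry M. The terms [u j.+1] and [v j]
   involve the same E, and [g j.+1] and [w j] the same M. *)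
pose u j := (- (2 * j)%:R * a2 k j) *: E (m + 1 + k + j) (2 * j).-1 x.
pose v j := (2 * (m + 1 + k + j)%:R * b2 k j) *: E (m + 2 + k + j) (2 * j + 1) x.
pose g j := ((2 * (m + k + j)%:R - 2 * h%:R) * a2 k j + (2 * j + 1)%:R * b2 k j)
  *: M (m + 1 + k + j) (2 * j) x.
pose w j := (- (4 * (m + 1 + k + j)%:R) * b2 k j) *: M (m + 2 + k + j) (2 * j).+2 x.
transitivity (\sum_(0 <= j < k) u j + \sum_(0 <= j < k) v j +
    \sum_(0 <= j < k) g j + \sum_(0 <= j < k) w j).
  rewrite scaler_sumr -!big_split /=; apply: eq_bigr => j _.
  rewrite /u /v /g /w.
  have -> : (m + j + 1 + k = m + 1 + k + j)%N by lia.
  have -> : ((m + 1 + k + j).+1 = m + 2 + k + j)%N by lia.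
  have -> : ((2 * j + 1).+1 = (2 * j).+2)%N by lia.
  have -> : ((2 * j + 1).-1 = 2 * j)%N by lia.
  have nR : n%:R = 2 * h%:R + 1 :> R by rewrite nE natrD natrM.
  rewrite nR; have -> : (m + 1 + k + j)%:R = (m + k + j)%:R + 1 :> R.
    by rewrite natr1; congr (_%:R); lia.
  move: (E _ _ x) (E _ _ x) (M _ _ x) (M _ _ x) => e1 e2 e3 e4.
  cl_ring.
have u0 : u 0%N = 0 by rewrite /u muln0 oppr0 mul0r scale0r.
have uk : u k = 0 by rewrite /u coef_a2_out // mulr0 scale0r.
have gk : g k = 0 by rewrite /g coef_a2_out // coef_b2_out // !mulr0 addr0 scale0r.
rewrite (sum_recl_last0 uk) u0 add0r (sum_recl_last0 gk).
(* This term has no partner in [w]; it is the j = 0 term of the second sum in [odd_sum]. *)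
have -> : g 0%N = -1 *: (2 *: (b1 k 0 *: M (m + 1 + k + 0) (2 * 0) x)).
  by rewrite /g [2 *: _]scalerA coef_b1_rec0 // scalerA !muln0 !addn0 add0n; congr (_ *: _); ring.
have uv : \sum_(0 <= j < k) u j.+1 + \sum_(0 <= j < k) v j =
    2 *: \sum_(0 <= j < k) a1 k j *: E (m + j + 2 + k) (2 * j + 1) x.
  rewrite -big_split scaler_sumr; apply: eq_big_nat => j /andP[_ jk] /=.
  rewrite /u /v scalerA coef_a1_rec //.
  have -> : (m + 1 + k + j.+1 = m + 2 + k + j)%N by lia.
  have -> : (m + j + 2 + k = m + 2 + k + j)%N by lia.
  have -> : ((2 * j.+1).-1 = 2 * j + 1)%N by lia.
  by rewrite -scalerDl.
have gw : \sum_(0 <= j < k) g j.+1 + \sum_(0 <= j < k) w j =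
    -1 *: (2 *: \sum_(0 <= j < k) b1 k j.+1 *: M (m + 1 + k + j.+1) (2 * j.+1) x).
  rewrite -big_split !scaler_sumr; apply: eq_big_nat => j /andP[_ jk] /=.
  rewrite /g /w [2 *: _]scalerA coef_b1_rec // scalerA.
  have -> : (m + 2 + k + j = m + 1 + k + j.+1)%N by lia.
  have -> : ((2 * j).+2 = 2 * j.+1)%N by lia.
  by rewrite -scalerDl; congr (_ *: _); ring.
rewrite uv -!addrA gw /odd_sum [in RHS]big_nat_recl // [RHS]scalerDr.
by rewrite [2 *: (-1 *: _)]scalerA [2 * -1]mulrC -scalerA !scalerDr.
Qed.

Lemma has_dirac_odd_sum k x : (m + 2 * k + 2 <= h)%N ->
  Qc_norm s x != 0 -> has_dirac (odd_sum k) x (2 *: even_sum k.+1 x).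
Proof.
move=> kh N0.
have H := has_diracD
  (has_dirac_sum (index_iota 0 k) (fun j =>
    has_diracZ (a1 k j) (has_dirac_skmon (m + j + 2 + k) (2 * j + 1) N0)))
  (has_diracZ (-1) (has_dirac_sum (index_iota 0 k.+1) (fun j =>
    has_diracZ (b1 k j) (has_dirac_kmon (m + 1 + k + j) (2 * j) N0)))).
move: H; congr has_dirac.
pose u j := (2 * (m + 1 + k + j)%:R * b1 k j) *: E (m + 2 + k + j) (2 * j) x.
pose v j := (- (4 * (m + 1 + k + j)%:R) * b1 k j) *: M (m + 2 + k + j) (2 * j + 1) x.
pose g j := ((2 * j)%:R * b1 k j) *: M (m + 1 + k + j) (2 * j).-1 x.
pose p j := (- (2 * j + 1)%:R * a1 k j) *: E (m + 2 + k + j) (2 * j) x.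
pose q j := ((2 * (m + 1 + k + j)%:R - 2 * h%:R) * a1 k j) *: M (m + 2 + k + j) (2 * j + 1) x.
have pk : p k = 0 by rewrite /p coef_a1_out // mulr0 scale0r.
have qk : q k = 0 by rewrite /q coef_a1_out // mulr0 scale0r.
have g0 : g 0%N = 0 by rewrite /g muln0 mul0r scale0r.
have gk : g k.+1 = 0 by rewrite /g coef_b1_out // mulr0 scale0r.
(* The terms from [coef_a1] stop below k, but vanish at k; including that index gives all sums the
   range of [even_sum k.+1]. *)
transitivity (\sum_(0 <= j < k.+1) p j + \sum_(0 <= j < k.+1) u j
    + (\sum_(0 <= j < k.+1) q j + \sum_(0 <= j < k.+1) v j + \sum_(0 <= j < k.+1) g j)).
  transitivity (\sum_(0 <= j < k) (p j + q j) + \sum_(0 <= j < k.+1) (u j + v j + g j)).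
    congr (_ + _).
      apply: eq_bigr => j _; rewrite /p /q.
      have -> : (m + j + 2 + k = m + 2 + k + j)%N by lia.
      have -> : ((2 * j + 1).-1 = 2 * j)%N by lia.
      have nR : n%:R = 2 * h%:R + 1 :> R by rewrite nE natrD natrM.
      rewrite nR; have -> : (m + 2 + k + j)%:R = (m + 1 + k + j)%:R + 1 :> R.
        by rewrite natr1; congr (_%:R); lia.
      by move: (E _ _ x) (M _ _ x) => e1 e2; cl_ring.
    rewrite scaler_sumr; apply: eq_bigr => j _; rewrite /u /v /g.
    have -> : ((m + 1 + k + j).+1 = m + 2 + k + j)%N by lia.
    have -> : ((2 * j).+1 = 2 * j + 1)%N by lia.
    by move: (E _ _ x) (M _ _ x) (M _ _ x) => e1 e2 e3; cl_ring.
  have -> : \sum_(0 <= j < k.+1) p j = \sum_(0 <= j < k) p j by rewrite big_nat_recr //= pk addr0.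
  have -> : \sum_(0 <= j < k.+1) q j = \sum_(0 <= j < k) q j by rewrite big_nat_recr //= qk addr0.
  by rewrite !big_split /= -![_ + _ + \sum_(0 <= j < k.+1) g j]addrA addrACA.
rewrite [X in _ + (_ + X)](sum_recl_last0 gk) g0 add0r /even_sum scalerDr.
congr (_ + _).
  rewrite -big_split scaler_sumr; apply: eq_big_nat => j /andP[_ jk] /=.
  rewrite /u /p scalerA coef_a2_rec //.
  have -> : (m + j + 1 + k.+1 = m + 2 + k + j)%N by lia.
  by rewrite -scalerDl.
rewrite -!big_split !scaler_sumr; apply: eq_big_nat => j /andP[_ jk] /=.
rewrite /q /v /g [2 *: (-1 *: _)]scalerA [2 * -1]mulrC
  -[(-1 * 2) *: _]scalerA [2 *: _]scalerA coef_b2_rec // scalerA.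
have -> : (m + 1 + k.+1 + j = m + 2 + k + j)%N by lia.
have -> : (m + 1 + k + j.+1 = m + 2 + k + j)%N by lia.
have -> : ((2 * j.+1).-1 = 2 * j + 1)%N by lia.
by rewrite -!scalerDl; congr (_ *: _); ring.
Qed.

(** Since n = 2h + 1, the left side is -2(h - m) M(m+1, 0), while [odd_sum 0] is -m! M(m+1, 0); this
    is the origin of the division by m!. *)
Lemma has_dirac_skmon0 x : (m < h)%N -> Qc_norm s x != 0 ->
  has_dirac (E m.+1 0) x ((2 * (h - m)%N%:R / m`!%:R) *: odd_sum 0 x).
Proof.
move=> mh N0; have := has_dirac_skmon m.+1 0 N0; congr has_dirac.
rewrite /odd_sum big_geq // big_nat1 add0r oppr0 scale0r add0r !scalerA.
have -> : (m + 1 + 0 + 0 = m.+1)%N by lia.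
congr (_ *: _).
have -> : b1 0 0 = m`!%:R.
  by rewrite /coef_b1 !addn0 !muln0 !subn0 expn0 binn bin0 fact0 !(mul1n, muln1).
rewrite natrB 1?ltnW // nE natrD natrM -natr1.
by field; rewrite factR_neq0.
Qed.

(** Each D contributes a factor 2 and swaps the two kinds of sums. The count starts at one
    derivative because [even_sum 0] is an empty sum, not the kernel. *)
Lemma iter_dirac_SL_kernel k x : (m + k.+1 <= h)%N -> Qc_norm s x != 0 ->
  iter k.+1 (@dirac_op R n) (iter m (@laplacian R n) (SL_kernel s)) x =
  (2 ^+ k.+1 * (h - m)%N%:R * gamma_coef R h m / m`!%:R) *:
    (if odd k then even_sum k.+1./2 x else odd_sum k./2 x).
Proof.
elim: k x => [|k IH] x kh N0.
  rewrite [LHS](_ : _ = dirac_op (iter m (@laplacian R n) (SL_kernel s)) x) //.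
  apply: dirac_opE; apply: (@has_dirac_near _ _ (fun y => gamma_coef R h m *: E m.+1 0 y)).
    have mh : (m <= h)%N by lia.
    near=> y; rewrite (iter_laplacian_SL_kernel nE mh) //.
    by near: y; exact: near_Qc_norm_neq0.
  have := has_diracZ (gamma_coef R h m) (has_dirac_skmon0 _ N0); rewrite scalerA.
  have mh : (m < h)%N by lia.
  move=> /(_ mh); congr (has_dirac _ _ (_ *: _)); rewrite expr1; ring.
set c := 2 ^+ k.+1 * _ * _ / _ in IH.
have -> : 2 ^+ k.+2 * (h - m)%N%:R * gamma_coef R h m / m`!%:R = c * 2 by rewrite /c exprS; ring.
rewrite iterS; apply: dirac_opE.
(* The induction hypothesis holds at all points near x, so the closed form may replace the iterate
   under D. *)
apply: (@has_dirac_near _ _ (fun y => c *: (if odd k then even_sum k.+1./2 y else odd_sum k./2 y))).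
  have kh' : (m + k.+1 <= h)%N by lia.
  near=> y; rewrite (IH _ kh') //.
  by near: y; exact: near_Qc_norm_neq0.
rewrite -scalerA; apply: has_diracZ; rewrite /=.
have ke := odd_double_half k; case ko: (odd k) => /=; rewrite ko in ke.
  have -> : uphalf k = (k./2).+1 by rewrite uphalf_half ko.
  apply: has_dirac_even_sum => //; lia.
apply: has_dirac_odd_sum => //; lia.
Unshelve. all: by end_near. Qed.

End DiracIteration.

(** * The two parities of beta *)

Theorem theorem3p7 (R : realType) (n m beta : nat) (s x : 'rV[R]_n.+1) :
  odd n ->
  (1 <= beta)%N ->
  let h := ((n - 1) %/ 2)%N in
  (m + beta <= h)%N ->
  ~ slice_sphere x (paravector s) ->
  let C : R := 2 ^+ beta * (h - m)%N%:R * gamma_coef R h m / m`!%:R in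
  let lhs : clifford R n :=
    iter beta (@dirac_op R n) (iter m (@laplacian R n) (SL_kernel s)) x in
  let t : clifford R n := paravector s - (x 0 0)%:A in
  (forall k : nat, beta = (2 * k + 1)%N ->
     lhs = C *:
       ((paravector s - para_conj x) *
          (\sum_(0 <= j < k) coef_a1 R h m k j *:
             (Qc_negpow s x (m + j + 2 + k) * t ^+ (2 * j + 1)))
        - \sum_(0 <= j < k.+1) coef_b1 R h m k j *:
             (Qc_negpow s x (m + 1 + k + j) * t ^+ (2 * j))))
  /\
  (forall k : nat, (1 <= k)%N -> beta = (2 * k)%N ->
     lhs = C *:
       ((paravector s - para_conj x) *
          (\sum_(0 <= j < k) coef_a2 R h m k j *:
             (Qc_negpow s x (m + j + 1 + k) * t ^+ (2 * j)))
        - \sum_(0 <= j < k) coef_b2 R h m k j *: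
             (Qc_negpow s x (m + 1 + k + j) * t ^+ (2 * j + 1)))).
Proof.
move=> nodd beta1 h mh sx C lhs t.
have nE : n = (2 * h + 1)%N by rewrite /h; lia.
have n0 : (0 < n)%N by rewrite nE; lia.
have N0 := Qc_norm_neq0 n0 sx.
(* The parity tested is that of [beta.-1], as [iter_dirac_SL_kernel] is indexed by one less than the
   number of derivatives. *)
have lhsE : lhs = C *:
    (if odd beta.-1 then even_sum h m s beta./2 x
    else odd_sum h m s beta.-1./2 x).
  by rewrite /lhs /C -(prednK beta1); apply: iter_dirac_SL_kernel => //; rewrite prednK.
have skE I r (c : I -> R) (e d : I -> nat) :
    (paravector s - para_conj x) * (\sum_(j <- r) c j *: (Qc_negpow s x (e j) * t ^+ d j)) =
    \sum_(j <- r) c j *: skmon s (e j) (d j) x.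
  by rewrite mulr_sumr; apply: eq_bigr => j _; rewrite -scalerAr.
split => [k bE|k k1 bE]; rewrite skE -scaleN1r lhsE bE.
  have -> : (2 * k + 1).-1 = k.*2 by lia.
  by rewrite odd_double doubleK.
have -> : odd (2 * k).-1 by rewrite -subn1 oddB ?oddM //; lia.
by rewrite mul2n doubleK.
Qed.
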